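(* Let $(T,d)$ be a compact metric space, $\Sigma$ its Borel $\sigma$-algebra, $\mu:\Sigma\to[0,\infty)$ a regular, countably additive, pointwise non atomic measure, and $X$ a Banach space. Let $F:T\to cwk(X)$ be H-integrable. Then for every $E\in\Sigma$ one has $J_E(F)=\Phi(F,E)$, and therefore $\Phi(F,E)\in cwk(X)$.
   Context: Pointwise non atomic means $\mu(\{t\})=0$ for every $t\in T$. $cwk(X)$ is the family of all non-empty convex weakly compact subsets of $X$; $d_H$ is the Hausdorff distance. A gauge is any map $\gamma:T\to(0,\infty)$. For $E\in\Sigma$, a partition of $E$ is a finite family $\Pi=\{(E_i,t_i):i=1,\dots,k\}$ with $t_i\in T$, $E_i\in\Sigma$, $\mu(E_i\cap E_j)=0$ for $i\ne j$, and $\bigcup_i E_i=E$ (the tags $t_i$ need not lie in $E_i$). It is $\gamma$-fine if $d(w,t_i)<\gamma(t_i)$ for every $w\in E_i$ and every $i$. Write $\sum_\Pi F=\sum_i \mu(E_i)F(t_i)$ (Minkowski sum). $F:T\to cwk(X)$ is H-integrable on $E$ with integral $J_E(F)\in cwk(X)$ if for every $\varepsilon>0$ there is a gauge $\gamma$ with $d_H(\sum_{\Pi}F,J_E(F))\le\varepsilon$ for every $\gamma$-fine partition $\Pi$ of $E$. ''$F$ is H-integrable'' means H-integrable on $T$; it is a known fact that $F$ is then H-integrable on every $E\in\Sigma$, so $J_E(F)$ exists for every $E\in\Sigma$. The $(\|\cdot\|)$-integral $\Phi(F,E)$ is the set of all $z\in X$ such that for every $\varepsilon>0$ there is a gauge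 $\gamma$ with $\inf_{c\in\sum_{\Pi}F}\|z-c\|\le\varepsilon$ for every $\gamma$-fine partition $\Pi$ of $E$. *)

(* Defs.v *)
From HB Require Import structures.
From mathcomp Require Import all_boot all_order all_algebra.
From mathcomp Require Import all_classical all_reals all_analysis.

Set Implicit Arguments.
Unset Strict Implicit.
Unset Printing Implicit Defensive.

Import Order.TTheory GRing.Theory Num.Theory.
Import numFieldNormedType.Exports.

Local Open Scope classical_set_scope.
Local Open Scope ring_scope.

(* Measurable types are pointed in the library, hence so are the metric spaces
   on which a Borel measure lives. *)
#[short(type="pointedMetricType")]
HB.structure Definition PointedMetric (R : numDomainType) :=
  {T of Metric R T & Pointed T}.

Definition borel (R : numDomainType) (T : pointedMetricType R) :=
  g_sigma_algebraType (@open T).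

HB.instance Definition _ (R : numDomainType) (T : pointedMetricType R) :=
  Measurable.on (borel T).

Section Measures.
Context (R : realType) (T : pointedMetricType R).

Definition regular_measure (mu : {finite_measure set (borel T) -> \bar R}) :=
  forall A : set T, measurable (A : set (borel T)) ->
    mu A = ereal_inf [set mu U | U in [set U : set T | open U /\ A `<=` U]] /\
    mu A = ereal_sup [set mu K | K in [set K : set T | compact K /\ K `<=` A]].

Definition pointwise_non_atomic (mu : {finite_measure set (borel T) -> \bar R}) :=
  forall t : T, mu [set t] = 0%E.

End Measures.

Section WeaklyCompactConvex.
Context (R : realType) (X : normedModType R).

Definition topological_dual := {f : {linear X -> R^o} | continuous (f : X -> R^o)}.

(* X with the coarsest topology making every element of its dual continuous *)
Definition weak_space :=
  sup_topology (fun f : topological_dual =>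
    Topological.on (initial_topology (sval f : X -> R^o))).

HB.instance Definition _ := Topological.on weak_space.

Definition weakly_compact (K : set X) := compact (K : set weak_space).

Definition cwk : set (set X) :=
  [set K : set X | [/\ K !=set0, convex_set K & weakly_compact K]].

End WeaklyCompactConvex.

Section HausdorffDistance.
Context (R : realType) (X : normedModType R).
Local Open Scope ereal_scope.

Definition dist_to (z : X) (C : set X) : \bar R :=
  ereal_inf [set `|z - c|%:E | c in C].

Definition hausdorff_dist (A B : set X) : \bar R :=
  maxe (ereal_sup [set dist_to a B | a in A])
       (ereal_sup [set dist_to b A | b in B]).

End HausdorffDistance.

Section Integrals.
Context (R : realType) (T : pointedMetricType R) (X : normedModType R).
Variable mu : {finite_measure set (borel T) -> \bar R}.

Definition is_gauge (gamma : T -> R) := forall t, 0 < gamma t.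

(* A partition {(E_i, t_i) : i = 1, ..., k} is given by the two families
   (E_i) and (t_i) indexed by 'I_k; the sets only overlap in null sets and the
   tags are unconstrained. *)
Definition is_partition (E : set T) k (P : 'I_k -> set T) :=
  [/\ forall i, measurable (P i : set (borel T)),
      forall i j, i != j -> mu (P i `&` P j) = 0%E &
      \bigcup_i P i = E].

Definition is_fine (gamma : T -> R) k (P : 'I_k -> set T) (t : 'I_k -> T) :=
  forall i w, P i w -> mdist w (t i) < gamma (t i).

(* the Minkowski sum of the sets mu(E_i) F(t_i) *)
Definition riemann_sum (F : T -> set X) k (P : 'I_k -> set T) (t : 'I_k -> T) :
    set X :=
  [set \sum_(i < k) fine (mu (P i)) *: x i
    | x in [set x : 'I_k -> X | forall i, F (t i) (x i)]].

Definition is_Hintegral (F : T -> set X) (E : set T) (J : set X) :=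
  cwk J /\
  forall eps : R, 0 < eps -> exists2 gamma : T -> R, is_gauge gamma &
    forall k (P : 'I_k -> set T) (t : 'I_k -> T),
      is_partition E P -> is_fine gamma P t ->
      (hausdorff_dist (riemann_sum F P t) J <= eps%:E)%E.

Definition Hintegrable_on (F : T -> set X) (E : set T) :=
  exists J, is_Hintegral F E J.

Definition Hintegrable (F : T -> set X) := Hintegrable_on F [set: T].

(* J_E(F); the default value set0, taken when F is not H-integrable on E, does
   not belong to cwk X *)
Definition Hintegral (F : T -> set X) (E : set T) : set X :=
  xget set0 (is_Hintegral F E).

Definition norm_integral (F : T -> set X) (E : set T) : set X :=
  [set z | forall eps : R, 0 < eps -> exists2 gamma : T -> R, is_gauge gamma &
    forall k (P : 'I_k -> set T) (t : 'I_k -> T),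
      is_partition E P -> is_fine gamma P t ->
      (dist_to z (riemann_sum F P t) <= eps%:E)%E].

End Integrals.

(* Main.v *)
From HB Require Import structures.
Require Import Defs.
From mathcomp Require Import ssrAC.
From mathcomp Require Import all_boot all_order all_algebra.
From mathcomp Require Import all_classical all_reals all_analysis.
From mathcomp Require Import ring lra.

Set Implicit Arguments.
Unset Strict Implicit.
Unset Printing Implicit Defensive.

Import Order.TTheory GRing.Theory Num.Theory.
Import numFieldNormedType.Exports.

Local Open Scope classical_set_scope.
Local Open Scope ring_scope.

(* The Riemann sums of F over ever finer partitions of E form a filter of convex
   weakly compact sets, and Phi(F, E) is its limit: the points whose distance to
   the sums tends to 0. Completing two partitions of E by a common partition of
   the complement and cancelling the common Minkowski summand (Rådström) shows
   that H-integrability on T makes this filter Cauchy for the Hausdorff distance.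
   Along an ultrafilter, points approximated within every e by the sums have
   approximants which converge weakly for each e; the weak limits are Cauchy as e
   tends to 0, because the norm is weakly lower semicontinuous (Hahn-Banach), and
   their limit lies in Phi(F, E). Hence Phi(F, E) is convex, weakly compact and
   the Hausdorff limit of the sums, so it is an H-integral of F on E; any other
   one is norm closed and at Hausdorff distance 0 from it. *)

(** * Hahn-Banach: functionals of norm at most 1 attaining the norm at a given point *)

Section HahnBanach.
Context (R : realType) (X : normedModType R) (a : X).

(** Graphs of partial linear functionals below the norm. The prescribed value at [a] is required of
    non-empty graphs only, so that the union of the empty chain qualifies in Zorn's lemma. *)
Definition dominated_graph (G : set (X * R)) :=
  [/\ forall u v t, G u -> G v -> G (u.1 + t *: v.1, u.2 + t * v.2),
      forall u, G u -> u.2 <= `|u.1| &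
      forall u, G u -> G (a, `|a|)].

Lemma dominated_graph_bigcup (C : set (set (X * R))) :
  C `<=` dominated_graph -> total_on C subset ->
  dominated_graph (\bigcup_(G in C) G).
Proof.
move=> CD Ctot; split.
- move=> u v t [G CG Gu] [H CH Hv].
  have [GH|HG] := Ctot _ _ CG CH.
    by exists H => //; have [Hlin _ _] := CD _ CH; exact: Hlin _ _ _ (GH _ Gu) Hv.
  by exists G => //; have [Glin _ _] := CD _ CG; exact: Glin _ _ _ Gu (HG _ Hv).
- by move=> u [G CG Gu]; have [_ Gdom _] := CD _ CG; exact: Gdom.
- by move=> u [G CG Gu]; exists G => //; have [_ _ Ga] := CD _ CG; exact: Ga Gu.
Qed.

(** The value at [v] must lie above each [u.2 - |u.1 - v|] and below each [w.2 + |w.1 - v|].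
    Domination and the triangle inequality make these bounds compatible; [c] is the supremum of the
    lower ones. *)
Lemma dominated_graph_extend (G : set (X * R)) (v : X) :
  dominated_graph G -> G (0, 0) ->
  exists c, dominated_graph
    [set (u.1 + t *: v, u.2 + t * c) | u in G & t in [set: R]].
Proof.
move=> [Glin Gdom Ga] G0.
pose S := [set u.2 - `|u.1 - v| | u in G].
have Sub w : G w -> ubound S (w.2 + `|w.1 - v|).
  move=> Gw _ [u Gu <-].
  have /Gdom /= := Glin _ _ (-1) Gu Gw; rewrite scaleN1r mulN1r => uw.
  have := ler_distD v u.1 w.1; rewrite [`|v - _|]distrC; lra.
have S0 : S !=set0 by exists (0 - `|0 - v|), (0, 0).
have Sle w : G w -> w.2 - `|w.1 - v| <= sup S.
  move=> Gw; apply: ub_le_sup; last by exists w.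
  by exists (0 + `|0 - v|); exact: (Sub (0, 0)).
have Sge w : G w -> sup S <= w.2 + `|w.1 - v|.
  by move=> Gw; apply: ge_sup => //; exact: Sub.
exists (sup S); split.
- move=> _ _ t [u Gu [r _ <-]] [w Gw [s _ <-]] /=.
  exists (u.1 + t *: w.1, u.2 + t * w.2); first exact: Glin.
  exists (r + t * s) => //=; congr pair; last by ring.
  by rewrite scalerDl scalerDr scalerA addrACA.
- move=> _ [u Gu [t _ <-]] /=.
  (* Rescaling by [t] reduces to the bounds at [- t^-1] times [u]: the lower one for negative [t],
     the upper one for positive [t]. *)
  have [t0|t0|->] := ltgtP t 0; last by rewrite scale0r mul0r !addr0; exact: Gdom.
    have := Sle _ (Glin _ _ (- t^-1) G0 Gu).
    rewrite /= !add0r => h.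
    have -> : u.1 + t *: v = - t *: ((- t^-1) *: u.1 - v).
      by rewrite scalerBr scalerA mulrNN divff ?lt_eqF// scale1r scaleNr opprK.
    rewrite normrZ gtr0_norm ?oppr_gt0//.
    have := ler_wpM2l (ltW (_ : 0 < - t)) h; rewrite oppr_gt0 => /(_ t0).
    rewrite mulrBr mulrA mulrNN divff ?lt_eqF// mul1r; lra.
  have := Sge _ (Glin _ _ (- t^-1) G0 Gu).
  rewrite /= !add0r => h.
  have -> : u.1 + t *: v = - t *: ((- t^-1) *: u.1 - v).
    by rewrite scalerBr scalerA mulrNN divff ?gt_eqF// scale1r scaleNr opprK.
  rewrite normrZ normrN gtr0_norm//.
  have := ler_wpM2l (ltW t0) h.
  rewrite mulrDr mulrA mulrN divff ?gt_eqF// mulN1r; lra.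
- move=> _ [u Gu _]; exists (a, `|a|); first exact: Ga Gu.
  by exists 0; rewrite //= scale0r mul0r !addr0.
Qed.

Lemma maximal_dominated_graph : exists G,
  [/\ dominated_graph G, G (a, `|a|) & forall v, exists c, G (v, c)].
Proof.
have [G [DG maxG]] := Zorn_bigcup dominated_graph_bigcup.
(* The empty graph is dominated but not maximal: the line through [a] extends it. *)
have Gn0 : G !=set0.
  apply: contrapT => /set0P/negP; rewrite negbK => /eqP G0; subst G.
  pose L := [set (t *: a, t * `|a|) | t in [set: R]].
  apply: (maxG L).
    split; first exact: sub0set.
    by move=> /(_ (0 *: a, 0 * `|a|)); apply; exists 0.
  split.
  - move=> _ _ t [r _ <-] [s _ <-]; exists (r + t * s) => //=.
    by rewrite scalerDl scalerA mulrDl mulrA.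
  - move=> _ [t _ <-] /=; rewrite normrZ ler_wpM2r//; exact: ler_norm.
  - by move=> _ _; exists 1; rewrite ?scale1r ?mul1r.
have [Glin _ Ga'] := DG; have Ga : G (a, `|a|) by case: Gn0 => u /Ga'.
have G0 : G (0, 0).
  by have := Glin _ _ (-1) Ga Ga; rewrite /= scaleN1r mulN1r !subrr.
exists G; split => // v; apply: contrapT => Gv.
have [c Dc] := dominated_graph_extend v DG G0.
apply: (maxG _ _ Dc); split.
  move=> [x r] Gxr; exists (x, r) => //; exists 0 => //.
  by rewrite /= scale0r mul0r !addr0.
move=> sub; apply: Gv; exists c; apply: sub.
by exists (0, 0) => //; exists 1 => //=; rewrite scale1r mul1r !add0r.
Qed.

Lemma norming_functional :
  exists f : topological_dual X, sval f a = `|a| /\ forall x, `|sval f x| <= `|x|.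
Proof.
have [G [[Glin Gdom _] Ga Gtot]] := maximal_dominated_graph.
have [f Gf] := choice Gtot.
(* The graph contains [(0, r - s)] and [(0, s - r)], and domination at 0 makes both values
   nonpositive. *)
have Gfun x r s : G (x, r) -> G (x, s) -> r = s.
  move=> Gr Gs; apply/eqP; rewrite eq_le; apply/andP; split.
    have /Gdom := Glin _ _ (-1) Gr Gs.
    by rewrite /= scaleN1r subrr normr0 mulN1r subr_le0.
  have /Gdom := Glin _ _ (-1) Gs Gr.
  by rewrite /= scaleN1r subrr normr0 mulN1r subr_le0.
have G0 : G (0, 0).
  by have := Glin _ _ (-1) Ga Ga; rewrite /= scaleN1r mulN1r !subrr.
have flin : linear (f : X -> R^o).
  move=> t x y; apply: (Gfun (t *: x + y)) => //.
  have := Glin _ _ t (Gf y) (Gf x).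
  by rewrite /= [y + _]addrC [f y + _]addrC.
have fle x : `|f x| <= `|x|.
  rewrite ler_norml; apply/andP; split; last exact: Gdom (Gf x).
  have /Gdom := Glin _ _ (-1) G0 (Gf x).
  by rewrite /= !add0r scaleN1r normrN mulN1r lerNl.
pose fL : {linear X -> R^o} := HB.pack (f : X -> R^o)
  (GRing.isLinear.Build _ _ _ _ (f : X -> R^o) flin).
have fcont : continuous (fL : X -> R^o).
  apply/bounded_linear_continuous/linear_boundedP; exists 1; split => //.
  move=> M M1 x; apply: (le_trans (fle x)).
  by rewrite ler_peMl// ltW.
exists (exist _ fL fcont); split => //.
exact: (Gfun a).
Qed.

End HahnBanach.

(** * Weak convergence, and weak compactness through ultrafilters *)

Section WeakConvergence.
Context (R : realType) (X : normedModType R).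

Definition weak_cvg I (U : set_system I) (g : I -> X) (z : X) :=
  forall f : topological_dual X, sval f (g i) @[i --> U] --> (sval f z : R^o).

Lemma cvg_initial_topology (S : choiceType) (T : topologicalType) (f : S -> T)
    (G : set_system S) (z : S) : Filter G ->
  G --> (z : initial_topology f) <-> f @ G --> f z.
Proof.
move=> FG; split=> [Gz|Gfz].
  by apply: cvg_trans (@initial_continuous _ _ f z); exact: cvg_app.
move=> A; rewrite nbhsE => -[_ [[B oB <-] Bfz] BA].
by apply: filterS BA _; apply: Gfz; exact: open_nbhs_nbhs.
Qed.

Lemma cvg_weak_space (G : set_system X) (z : X) : Filter G ->
  G --> (z : weak_space X) <-> weak_cvg G id z.
Proof.
move=> FG; split.
  by move=> /cvg_sup Gz f; apply/cvg_initial_topology; exact: Gz.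
by move=> Gz; apply/cvg_sup => f; apply/cvg_initial_topology; exact: Gz.
Qed.

Lemma weakly_compactP (K : set X) : weakly_compact K <->
  forall U, UltraFilter U -> U K -> exists2 z, K z & weak_cvg U id z.
Proof.
rewrite /weakly_compact compact_ultra; split => KU U UU UK.
  by have [z [Kz /cvg_weak_space]] := KU U UU UK; exists z.
by have [z Kz /cvg_weak_space] := KU U UU UK; exists z.
Qed.

End WeakConvergence.

Lemma ultra_fmap (I J : Type) (h : I -> J) (U : set_system I) :
  UltraFilter U -> UltraFilter (h @ U).
Proof.
move=> UU; split; first exact: fmap_proper_filter.
move=> G GG UG; apply/seteqP; split => // A GA.
have [//|UnA] := in_ultra_setVsetC (h @^-1` A) UU.
by have [? []] := filter_ex (filterI GA (UG (~` A) UnA)).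
Qed.

Section WeakLimits.
Context (R : realType) (X : normedModType R) (I : Type) (U : set_system I).

Lemma weakly_compact_cvg (K : set X) (g : I -> X) : UltraFilter U ->
  weakly_compact K -> (\forall i \near U, K (g i)) ->
  exists2 z, K z & weak_cvg U g z.
Proof.
move=> UU /weakly_compactP KU UKg.
by have [z Kz gz] := KU _ (ultra_fmap g UU) UKg; exists z.
Qed.

Context {FU : ProperFilter U}.

Lemma weak_cvg_cst (z : X) : weak_cvg U (fun=> z) z.
Proof. by move=> f; exact: cvg_cst. Qed.

Lemma weak_cvgB (g h : I -> X) (y z : X) :
  weak_cvg U g y -> weak_cvg U h z -> weak_cvg U (fun i => g i - h i) (y - z).
Proof.
move=> gy hz f; rewrite linearB; under eq_fun do rewrite linearB.
exact: cvgB (gy f) (hz f).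
Qed.

Lemma weak_cvg_lincomb k (c : 'I_k -> R) (g : 'I_k -> I -> X) (z : 'I_k -> X) :
  (forall j, weak_cvg U (g j) (z j)) ->
  weak_cvg U (fun i => \sum_j c j *: g j i) (\sum_j c j *: z j).
Proof.
move=> gz f; rewrite linear_sum; under eq_fun do rewrite linear_sum.
apply: cvg_big => [|j _]; first exact: add_continuous.
rewrite linearZ; under eq_fun do rewrite linearZ.
exact: cvgZr (gz j f).
Qed.

Lemma weak_cvgZ0 (r : I -> R) (g : I -> X) (z : X) :
  r @ U --> 0 -> weak_cvg U g z -> weak_cvg U (fun i => r i *: g i) 0.
Proof.
move=> r0 gz f; rewrite linear0; under eq_fun do rewrite linearZ.
by rewrite -(mul0r (sval f z)); exact: cvgM r0 (gz f).
Qed.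

Lemma cvg_weak_cvg (g : I -> X) (z : X) : g @ U --> z -> weak_cvg U g z.
Proof. by move=> gz f; exact: continuous_cvg (svalP f z) gz. Qed.

(** Weak lower semicontinuity of the norm: a functional norming [z] is at most [r] along [g], hence
    also at the limit. *)
Lemma weak_cvg_norm_le (g : I -> X) (z : X) (r : R) :
  weak_cvg U g z -> (\forall i \near U, `|g i| <= r) -> `|z| <= r.
Proof.
move=> gz gr; have [f [<- fle]] := norming_functional z.
apply: (cvgr_to_le (gz f)); near=> i.
by apply: le_trans (ler_norm _) (le_trans (fle _) _); near: i.
Unshelve. all: by end_near. Qed.

Lemma weak_cvg_unique (g : I -> X) (y z : X) :
  weak_cvg U g y -> weak_cvg U g z -> y = z.
Proof.
move=> gy gz; apply/eqP; rewrite -subr_eq0 -normr_le0.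
apply: weak_cvg_norm_le (weak_cvgB gy gz) _.
by near=> i; rewrite subrr normr0.
Unshelve. all: by end_near. Qed.

End WeakLimits.
Arguments weak_cvg_cst {R X I U FU} z.

(** * Open norm neighbourhoods of sets *)

Definition thicken (R : realType) (X : normedModType R) (e : R) (S : set X) :=
  [set z | exists2 c, S c & `|z - c| < e].

Section Thicken.
Context (R : realType) (X : normedModType R).
Implicit Types S : set X.

Lemma thicken_trans (d e : R) (y z : X) S :
  `|y - z| < d -> thicken e S z -> thicken (d + e) S y.
Proof.
move=> yz [c Sc zc]; exists c => //.
by rewrite (le_lt_trans (ler_distD z _ _))// ltrD.
Qed.

Lemma convex_setP S : convex_set S <->
  forall x y t, S x -> S y -> 0 <= t -> t <= 1 -> S (t *: x + (1 - t) *: y).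
Proof.
split=> [Sconv x y t Sx Sy t0 t1|Sconv x y t /set_mem Sx /set_mem Sy].
  exact: set_mem (Sconv x y (Itv01 t0 t1) (mem_set Sx) (mem_set Sy)).
by apply/mem_set/Sconv; rewrite ?ge0 ?le1.
Qed.

Lemma thicken_convex (e : R) S : convex_set S -> convex_set (thicken e S).
Proof.
move=> /convex_setP Sconv; apply/convex_setP => x y t [c Sc xc] [d Sd yd] t0 t1.
exists (t *: c + (1 - t) *: d); first exact: Sconv.
rewrite opprD addrACA -!scalerBr (le_lt_trans (ler_normD _ _))// !normrZ.
rewrite !ger0_norm ?subr_ge0//.
(* Strictness is drawn from the [t] summand alone, so [t = 0] is treated apart. *)
have [->|tn0] := eqVneq t 0; first by rewrite mul0r subr0 mul1r add0r.
rewrite [ltRHS](_ : e = t * e + (1 - t) * e); last by ring.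
apply: ltr_leD; first by rewrite ltr_pM2l// lt_def tn0.
by rewrite ler_wpM2l ?subr_ge0// ltW.
Qed.

(** Points of [S] tending to [z] in norm have, along an ultrafilter, a weak limit in [S]; uniqueness
    of weak limits identifies it with [z]. *)
Lemma weakly_compact_closed S (z : X) : weakly_compact S ->
  (forall e, 0 < e -> thicken e S z) -> S z.
Proof.
move=> Sw zS; have Fproper : ProperFilter (within S (nbhs z)).
  apply: Build_ProperFilter_ex => A /nbhs_ballP[e e0].
  have [c Sc zc] := zS e e0; move=> /(_ c) cA; exists c; apply: cA => //.
  by rewrite -ball_normE.
have [U [UU FU]] := ultraFilterLemma Fproper.
have [p Sp Up] := weakly_compact_cvg (g := id) UU Sw (FU _ (withinT _ _)).
suff -> : z = p by [].
apply: (weak_cvg_unique (U := U) (g := id)) Up; apply: cvg_weak_cvg.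
by apply: cvg_trans (cvg_within S); exact: FU.
Qed.

End Thicken.

(** * Cancellation of a weakly compact Minkowski summand *)

Section Cancellation.
Context (R : realType) (X : normedModType R).

Lemma convex_set_mean (B : set X) (b : nat -> X) n : convex_set B ->
  (forall i, B (b i)) -> B (n.+1%:R^-1 *: \sum_(i < n.+1) b i).
Proof.
move=> /convex_setP Bconv Bb; elim: n => [|n IHn].
  by rewrite big_ord1 invr1 scale1r.
have n2 : n.+2%:R != 0 :> R by rewrite pnatr_eq0.
have n1 : n.+1%:R != 0 :> R by rewrite pnatr_eq0.
rewrite big_ord_recr /= scalerDr.
have := Bconv _ _ (n.+1%:R / n.+2%:R) IHn (Bb n.+1).
rewrite scalerA [_ / _ * _]mulrAC divff// mul1r.
rewrite (_ : 1 - _ = n.+2%:R^-1); last first.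
  apply: (mulIf n2); rewrite mulrBl mul1r divfK// mulVf//.
  by rewrite -[n.+2]addn1 natrD addrAC subrr add0r.
apply; first by rewrite divr_ge0.
by rewrite ler_pdivrMr ?ltr0n// mul1r ler_nat.
Qed.

(* Iterating a + c_i = b_i + c_(i+1) + O(e) and averaging,
   a is within e of the mean of the b_i up to (c_n - c_0)/n, which tends weakly
   to 0. *)
Lemma weakly_compact_cancel (B C : set X) (a : X) (e : R) :
  convex_set B -> weakly_compact B -> weakly_compact C -> C !=set0 ->
  (forall c, C c -> exists b c', [/\ B b, C c' & `|a + c - (b + c')| <= e]) ->
  exists2 b, B b & `|a - b| <= e.
Proof.
move=> Bconv Bwc Cwc [c0 Cc0] aBC.
(* The default [(0, 0)] makes the choice total; the iterates start in [C] and stay there, so they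
   never meet it. *)
have /choice[h hP] c : exists bc : X * X, C c ->
    [/\ B bc.1, C bc.2 & `|a + c - (bc.1 + bc.2)| <= e].
  have [/aBC[b [c' bc]]|] := pselect (C c).
    by exists (b, c').
  by exists (0, 0).
pose c n := iter n (snd \o h) c0; pose b n := (h (c n)).1.
have Cc n : C (c n) by elim: n => //= n /hP[].
have Bb n : B (b n) by have [] := hP _ (Cc n).
have cS n : c n.+1 = (h (c n)).2 by [].
have sum_le n : `|n%:R *: a - \sum_(i < n) b i - (c n - c0)| <= n%:R * e.
  elim: n => [|n IHn].
    by rewrite big_ord0 scale0r /c /= !subrr normr0 mul0r.
  have [_ _ le_e] := hP _ (Cc n).
  rewrite big_ord_recr /= -natr1 scalerDl mulrDl scale1r mul1r.
  apply: le_trans (lerD IHn le_e); rewrite -cS -/(b n).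
  apply: le_trans (ler_normD _ _); rewrite le_eqVlt; apply/orP; left.
  apply/eqP; congr `|_|; set s := \sum_(i < n) b i.
  rewrite [a + c n]addrC -(addrA (c n)) [in RHS]opprB.
  rewrite -(addrA (_ - s) (c0 - c n)) subrKA !opprD opprK.
  by rewrite [LHS](AC ((2*2)*2) ((1*3)*(6*(2*(4*5))))).
(* One ultrafilter refining the tail filter gives weak limits of the means and of [c n.+1] at once,
   in place of subsequences. *)
have [U [UU FU]] := ultraFilterLemma (@eventually_filter).
pose m n := n.+1%:R^-1 *: \sum_(i < n.+1) b i.
have [p Bp mp] : exists2 p, B p & weak_cvg U m p.
  apply: weakly_compact_cvg => //; apply: nearW => n.
  exact: convex_set_mean.
have [q _ cq] : exists2 q, C q & weak_cvg U (fun n => c n.+1) q.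
  by apply: weakly_compact_cvg => //; exact: nearW.
exists p => //.
have r0 : n.+1%:R^-1 @[n --> U] --> (0 : R).
  by apply: cvg_trans (@cvg_harmonic R); exact: cvg_app.
have lim : weak_cvg U (fun n => a - m n - n.+1%:R^-1 *: (c n.+1 - c0)) (a - p).
  rewrite -[a - p]subr0; apply: weak_cvgB.
    by apply: weak_cvgB mp; exact: weak_cvg_cst.
  apply: weak_cvgZ0 r0 (weak_cvgB cq _); exact: weak_cvg_cst.
apply: weak_cvg_norm_le lim _; apply: nearW => n.
have n1 : n.+1%:R != 0 :> R by rewrite pnatr_eq0.
rewrite (_ : _ - _ = n.+1%:R^-1 *:
    (n.+1%:R *: a - \sum_(i < n.+1) b i - (c n.+1 - c0))).
  rewrite normrZ ger0_norm ?invr_ge0// mulrC ler_pdivrMr ?ltr0n// mulrC.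
  exact: sum_le.
by rewrite [RHS]scalerBr; congr (_ - _); rewrite scalerBr scalerA mulVf// scale1r.
Qed.

End Cancellation.

(** * Limits of filters of convex weakly compact sets *)

Section LimitSet.
Context (R : realType) (X : completeNormedModType R).
Context (F : set_system (set X)) {FF : ProperFilter F}.

Definition limit_set :=
  [set z | forall e : R, 0 < e -> \forall S \near F, thicken e S z].

Definition hausdorff_cauchy := forall e : R, 0 < e ->
  \forall S \near F, \forall S' \near F,
    S `<=` thicken e S' /\ S' `<=` thicken e S.

Context (F_cwk : \forall S \near F, cwk S).

(** A form of Grothendieck's criterion: points approximated arbitrarily well from weakly compact
    sets have weak limits. Completeness of [X] turns the approximate limits [p e] into [z]. *)
Lemma weak_cvg_limit_set I (U : set_system I) (g : I -> X) : UltraFilter U ->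
  (forall e : R, 0 < e ->
    \forall S \near F, \forall i \near U, thicken e S (g i)) ->
  exists2 z, limit_set z & weak_cvg U g z.
Proof.
move=> UU gF.
have approx S (e : R) : cwk S -> (\forall i \near U, thicken e S (g i)) ->
    exists p a, [/\ S p, weak_cvg U a p & \forall i \near U, `|g i - a i| < e].
  move=> [_ _ Swc] gS.
  have /choice[a aP] i : exists c, thicken e S (g i) -> S c /\ `|g i - c| < e.
    have [[c Sc gc]|] := pselect (thicken e S (g i)).
      by exists c.
    by exists 0.
  have [|p Sp ap] := weakly_compact_cvg (g := a) UU Swc.
    by apply: filterS gS => i /aP[].
  by exists p, a; split => //; apply: filterS gS => i /aP[].
have approx0 (e : R) : exists pa : X * (I -> X), 0 < e ->
    weak_cvg U pa.2 pa.1 /\ \forall i \near U, `|g i - pa.2 i| < e.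
  have [e0|_] := boolP (0 < e); last by exists (0, fun=> 0).
  have [S [/approx Sa gS]] := filter_ex (filterI F_cwk (gF e e0)).
  by have [p [a [_ ap ga]]] := Sa _ gS; exists (p, a).
have [pa paP] := choice approx0; pose p e := (pa e).1.
have p_le (e e' : R) : 0 < e -> 0 < e' -> `|p e - p e'| <= e + e'.
  move=> /paP[ap ga] /paP[ap' ga'].
  apply: weak_cvg_norm_le (weak_cvgB ap ap') _; near=> i.
  rewrite (le_trans (ler_distD (g i) _ _))// lerD// ltW//; last by near: i.
  by rewrite distrC; near: i.
have p_cauchy : cauchy_ex (p @ 0^'+).
  move=> e e0; exists (p (e / 3)).
  suff : \forall d \near 0^'+, ball (p (e / 3)) e (p d) by [].
  near=> d; rewrite -ball_normE /=.
  have d0 : 0 < d by near: d; exact: nbhs_right_gt.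
  have de : d < e / 3 by near: d; apply: nbhs_right_lt; lra.
  by have := p_le (e / 3) d ltac:(lra) d0; lra.
have pz : cvg (p @ 0^'+) by apply: cauchy_cvg; exact: cauchy_exP.
set z := lim (p @ 0^'+) in pz.
have p_near (d : R) : 0 < d -> exists e, [/\ 0 < e, e < d & `|p e - z| < d].
  move=> d0; have /cvgrPdist_lt/(_ d d0) pd := pz.
  have : \forall e \near 0^'+, [/\ 0 < e, e < d & `|p e - z| < d].
    near=> e; split; last by rewrite distrC; near: e.
      by near: e; exact: nbhs_right_gt.
    by near: e; exact: nbhs_right_lt.
  exact: filter_ex.
have gz : weak_cvg U g z.
  move=> f; apply/cvgrPdist_lt => e e0.
  have /cvgrPdist_lt/(_ (e / 3)) := svalP f 0.
  rewrite linear0 => /(_ ltac:(lra))/nbhs_ballP[d /= d0 fd].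
  have f_lt x : `|x| < d -> `|sval f x| < e / 3.
    by move=> xd; have := fd x; rewrite -ball_normE /= !sub0r !normrN; apply.
  have [d' [d'0 d'd pd']] := p_near d d0.
  have [ap ga] := paP d' d'0.
  have /cvgrPdist_lt/(_ (e / 3)) := ap f => /(_ ltac:(lra)) fap.
  (* Continuity of [f] at 0 controls the two outer differences, from [z] to [p d'] and from the
     approximant to [g i]; weak convergence controls the middle one. *)
  near=> i.
  have h1 : `|sval f (z - p d')| < e / 3 by apply: f_lt; rewrite distrC.
  have h2 : `|sval f (p d') - sval f ((pa d').2 i)| < e / 3 by near: i.
  have h3 : `|sval f ((pa d').2 i - g i)| < e / 3.
    by apply: f_lt; rewrite distrC; apply: lt_trans d'd; near: i.
  rewrite !linearB in h1 h3.
  apply: le_lt_trans (ler_distD (sval f (p d')) _ _) _.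
  have := ler_distD (sval f ((pa d').2 i)) (sval f (p d')) (sval f (g i)).
  by rewrite /= in h1 h2 h3 *; lra.
(* Approximants taken in [S] itself converge weakly to some [q] in [S], and semicontinuity bounds
   the norm of [z - q] by [e / 2]. *)
exists z => // e e0; have e2 : 0 < e / 2 by lra.
near=> S.
have [//||q [a [Sq aq ga]]] := approx S (e / 2).
- by near: S.
- by near: S; exact: gF.
exists q => //; apply: (@le_lt_trans _ _ (e / 2)); last by lra.
apply: weak_cvg_norm_le (weak_cvgB gz aq) _.
by apply: filterS ga => i /ltW.
Unshelve. all: by end_near. Qed.

Context (F_cauchy : hausdorff_cauchy).

(** The auxiliary [S'] may depend on [z]: it is taken close both to [z] and to [S], and [S] is fixed
    before [z], whence uniformity. *)
Lemma limit_set_sub_thicken (e : R) : 0 < e ->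
  \forall S \near F, limit_set `<=` thicken e S.
Proof.
move=> e0; have e2 : 0 < e / 2 by lra.
apply: filterS (F_cauchy e2) => S SF z /(_ _ e2) zF.
have [S' [[_ S'S] [c S'c zc]]] := filter_ex (filterI SF zF).
by rewrite (splitr e); apply: thicken_trans zc _; exact: S'S.
Qed.

(** Points [y S'] of [S'] within [e / 2] of [x] are indexed by the sets themselves; along an
    ultrafilter finer than [F] they converge weakly to a point of the limit set, still within
    [e / 2] of [x]. *)
Lemma sub_thicken_limit_set (e : R) : 0 < e ->
  \forall S \near F, S `<=` thicken e limit_set.
Proof.
move=> e0; have e2 : 0 < e / 2 by lra.
apply: filterS (F_cauchy e2) => S SF x Sx.
have /choice[y yP] S' : exists c, thicken (e / 2) S' x ->
    S' c /\ `|x - c| < e / 2.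
  have [[c Sc gc]|] := pselect (thicken (e / 2) S' x).
    by exists c.
  by exists 0.
have yF : \forall S' \near F, S' (y S') /\ `|x - y S'| < e / 2.
  by apply: filterS SF => S' [SS' _]; exact/yP/SS'.
have [U [UU FU]] := ultraFilterLemma FF.
have [d d0|z Lz yz] := weak_cvg_limit_set (g := y) UU.
  apply: filterS (F_cauchy d0) => S1 S1F; apply: FU.
  by apply: filterS (filterI S1F yF) => S2 [[_ S21] [/S21]].
exists z => //; apply: (@le_lt_trans _ _ (e / 2)); last by lra.
apply: weak_cvg_norm_le (weak_cvgB (weak_cvg_cst _) yz) _.
by apply: FU; apply: filterS yF => S' [_ /ltW].
Qed.

Lemma cwk_limit_set : cwk limit_set.
Proof.
split.
- have [S [[[x Sx] _ _] Slim]] :=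
    filter_ex (filterI F_cwk (sub_thicken_limit_set ltr01)).
  by have [z Lz _] := Slim x Sx; exists z.
- apply/convex_setP => y z t Ly Lz t0 t1 e e0; near=> S.
  have /convex_setP : convex_set (thicken e S).
    by apply: thicken_convex; have [] : cwk S by near: S.
  by apply => //; near: S; [exact: Ly|exact: Lz].
(* The limit set is uniformly close to the sets of the filter, so any ultrafilter on it is
   approximated as the criterion demands. *)
- apply/weakly_compactP => U UU UL; apply: weak_cvg_limit_set => e e0.
  apply: filterS (limit_set_sub_thicken e0) => S LS.
  exact: filterS UL.
Unshelve. all: by end_near. Qed.

End LimitSet.

(** * The Hausdorff distance in terms of open neighbourhoods *)

Section Distances.
Context (R : realType) (X : normedModType R).
Implicit Types A B S : set X.

Lemma dist_to_lt (z : X) S (e : R) : (dist_to z S < e%:E)%E <-> thicken e S z.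
Proof.
split=> [/ereal_inf_lt[_ [c Sc <-]]|[c Sc zc]].
  by rewrite lte_fin => zc; exists c.
apply: (@le_lt_trans _ _ `|z - c|%:E); last by rewrite lte_fin.
by apply: ereal_inf_lbound; exists c.
Qed.

Lemma hausdorff_dist_le_thicken A B (d e : R) : d < e ->
  (hausdorff_dist A B <= d%:E)%E -> A `<=` thicken e B /\ B `<=` thicken e A.
Proof.
move=> de; rewrite ge_max => /andP[AB BA].
have de' : (d%:E < e%:E)%E by rewrite lte_fin.
split=> z Sz; apply/dist_to_lt; apply: le_lt_trans de'.
  by apply: le_trans AB; apply: ereal_sup_ubound; exists z.
by apply: le_trans BA; apply: ereal_sup_ubound; exists z.
Qed.

Lemma hausdorff_dist_le A B (e : R) :
  A `<=` thicken e B -> B `<=` thicken e A -> (hausdorff_dist A B <= e%:E)%E.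
Proof.
move=> AB BA; rewrite ge_max.
apply/andP; split; apply: ge_ereal_sup => _ [z Sz <-].
  exact/ltW/dist_to_lt/AB.
exact/ltW/dist_to_lt/BA.
Qed.

End Distances.

(** * Riemann sums, juxtaposed partitions and existence of fine partitions *)

Definition cat_fam (A : Type) m n (f : 'I_m -> A) (g : 'I_n -> A)
  (i : 'I_(m + n)) : A :=
  match fintype.split i with inl j => f j | inr j => g j end.

Lemma cat_fam_lshift (A : Type) m n (f : 'I_m -> A) (g : 'I_n -> A) i :
  cat_fam f g (lshift n i) = f i.
Proof. by rewrite /cat_fam (unsplitK (@Datatypes.inl 'I_m 'I_n i)). Qed.

Lemma cat_fam_rshift (A : Type) m n (f : 'I_m -> A) (g : 'I_n -> A) i :
  cat_fam f g (rshift m i) = g i.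
Proof. by rewrite /cat_fam (unsplitK (@Datatypes.inr 'I_m 'I_n i)). Qed.

Section RiemannSums.
Context (R : realType) (T : pointedMetricType R) (X : normedModType R).
Variables (mu : {finite_measure set (borel T) -> \bar R}) (F : T -> set X).

Lemma cwk_riemann_sum k (P : 'I_k -> set T) (t : 'I_k -> T) :
  (forall i, cwk (F (t i))) -> cwk (riemann_sum mu F P t).
Proof.
move=> Fcwk; split.
- have /choice[x Fx] i : exists x, F (t i) x by have [] := Fcwk i.
  by exists (\sum_(i < k) fine (mu (P i)) *: x i), x.
- apply/convex_setP => _ _ r [x Fx <-] [y Fy <-] r0 r1.
  exists (fun i => r *: x i + (1 - r) *: y i).
    move=> i; have [_ /convex_setP Fconv _] := Fcwk i.
    exact: Fconv.
  rewrite !scaler_sumr -big_split /=; apply: eq_bigr => i _.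
  by rewrite scalerDr !scalerA [_ * r]mulrC [_ * (1 - r)]mulrC.
- apply/weakly_compactP => U UU US.
  (* Each point of the sum is split into summands; along the same ultrafilter every component
     converges weakly inside its own [F (t i)]. *)
  have /choice[x xP] z : exists x : 'I_k -> X, riemann_sum mu F P t z ->
      (forall i, F (t i) (x i)) /\ \sum_(i < k) fine (mu (P i)) *: x i = z.
    have [[x Fx xz]|] := pselect (riemann_sum mu F P t z); first by exists x.
    by exists (fun=> 0).
  have /choice[y yP] i : exists y, F (t i) y /\ weak_cvg U (fun z => x z i) y.
    have [_ _ Fwc] := Fcwk i.
    have [|y Fy xy] := weakly_compact_cvg (g := fun z => x z i) UU Fwc.
      by apply: filterS US => z /xP[].
    by exists y.
  exists (\sum_(i < k) fine (mu (P i)) *: y i).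
    by exists y => // i; have [] := yP i.
  have xy : weak_cvg U (fun z => \sum_(i < k) fine (mu (P i)) *: x z i)
      (\sum_(i < k) fine (mu (P i)) *: y i).
    by apply: weak_cvg_lincomb => i; have [] := yP i.
  move=> f; apply: cvg_trans (xy f); apply: near_eq_cvg.
  by apply: filterS US => z /xP[_ ->].
Qed.

(** This turns the sum over the complement of a set into a Minkowski summand, ready for
    cancellation. *)
Lemma riemann_sum_cat m n (P : 'I_m -> set T) (s : 'I_m -> T)
    (Q : 'I_n -> set T) (t : 'I_n -> T) :
  riemann_sum mu F (cat_fam P Q) (cat_fam s t) =
  [set x + y | x in riemann_sum mu F P s & y in riemann_sum mu F Q t].
Proof.
apply/seteqP; split=> [_ [x Fx <-]|_ [_ [x Fx <-] [_ [y Fy <-] <-]]].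
  rewrite big_split_ord /=.
  exists (\sum_(i < m) fine (mu (P i)) *: x (lshift n i)).
    exists (x \o @lshift m n) => // i.
    by have := Fx (lshift n i); rewrite cat_fam_lshift.
  exists (\sum_(i < n) fine (mu (Q i)) *: x (rshift m i)).
    exists (x \o @rshift m n) => // i.
    by have := Fx (rshift m i); rewrite cat_fam_rshift.
  by congr (_ + _); apply: eq_bigr => i _;
    rewrite ?cat_fam_lshift ?cat_fam_rshift.
exists (cat_fam x y).
  by move=> i; rewrite /cat_fam; case: fintype.split => j.
rewrite big_split_ord /=.
by congr (_ + _); apply: eq_bigr => i _;
    rewrite ?cat_fam_lshift ?cat_fam_rshift.
Qed.

Lemma is_partition_cat (E : set T) m n (P : 'I_m -> set T) (Q : 'I_n -> set T) :
  is_partition mu E P -> is_partition mu (~` E) Q ->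
  is_partition mu [set: T] (cat_fam P Q).
Proof.
move=> [mP PP PE] [mQ QQ QE]; split.
- by move=> i; rewrite /cat_fam; case: fintype.split => j.
- have PQ0 i j : mu (P i `&` Q j) = 0%E.
    rewrite (_ : _ `&` _ = set0) ?measure0//.
    apply/seteqP; split => // w [Pw Qw].
    have : (~` E) w by rewrite -QE; exists j.
    by apply; rewrite -PE; exists i.
  move=> i j ij; rewrite -(splitK i) -(splitK j) in ij *.
  case: (fintype.split i) (fintype.split j) ij => [i1|i1] [j1|j1] /= ij;
    rewrite ?cat_fam_lshift ?cat_fam_rshift //.
  + by apply: PP; apply: contra_neq ij => ->.
  + by rewrite setIC.
  + by apply: QQ; apply: contra_neq ij => ->.
- apply/seteqP; split => // w _; have [Ew|nEw] := pselect (E w).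
    move: Ew; rewrite -PE => -[i _ Pw].
    by exists (lshift n i) => //; rewrite cat_fam_lshift.
  have : (~` E) w by [].
  rewrite -QE => -[i _ Qw].
  by exists (rshift m i) => //; rewrite cat_fam_rshift.
Qed.

Lemma is_fine_cat (gamma : T -> R) m n (P : 'I_m -> set T) (s : 'I_m -> T)
    (Q : 'I_n -> set T) (t : 'I_n -> T) :
  is_fine gamma P s -> is_fine gamma Q t ->
  is_fine gamma (cat_fam P Q) (cat_fam s t).
Proof.
move=> Ps Qt i w; rewrite /cat_fam.
by case: fintype.split => j; [exact: Ps|exact: Qt].
Qed.

(** Finitely many interiors of gauge balls cover [T]; made disjoint and cut with [E] they form the
    partition. The tags are the centres, which may lie outside [E]. *)
Lemma fine_partition_exists (gamma : T -> R) (E : set T) :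
  compact [set: T] -> is_gauge gamma -> measurable (E : set (borel T)) ->
  exists k (P : 'I_k -> set T) (t : 'I_k -> T),
    is_partition mu E P /\ is_fine gamma P t.
Proof.
rewrite compact_cover => Tcover gamma0 mE.
have [|t _|D _ TD] := Tcover T [set: T] (fun t => (ball t (gamma t))°).
- by move=> t _; exact: open_interior.
- exists t => //; apply: nbhs_singleton; apply: nbhs_interior.
  exact: nbhsx_ballx.
pose s : seq T := finmap.enum_fset D; pose tag i := nth point s i.
(* The finite subcover is padded with empty sets, since [seqDU] acts on infinite sequences. *)
pose B i := if (i < size s)%N then (ball (tag i) (gamma (tag i)))° else set0.
have mB i : measurable (B i : set (borel T)).
  rewrite /B; case: ifP => _; last exact: measurable0.
  by apply: sub_sigma_algebra; exact: open_interior.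
have Bcover w : exists2 i, (i < size s)%N & seqDU B i w.
  have : (\bigcup_i seqDU B i) w.
    rewrite -seqDU_bigcup_eq; have [t tD tw] := TD w I.
    exists (index t s) => //; rewrite /B /tag index_mem nth_index//.
    by rewrite ifT.
  move=> [i _ iw]; exists i => //.
  by have := subset_seqDU iw; rewrite /B; case: ifP.
exists (size s), (fun i => E `&` seqDU B i), (fun i => tag i); split; last first.
  move=> i w [_ iw]; have := subset_seqDU iw.
  rewrite /B ltn_ord => /interior_subset.
  by rewrite ballEmdist /= metric_sym.
split.
- move=> i; apply: measurableI => //; apply: measurableD => //.
  exact: bigsetU_measurable.
- move=> i j ij; rewrite (_ : _ `&` _ = set0) ?measure0//.
  apply/seteqP; split => // w [[_ iw] [_ jw]].
  have /trivIsetP/(_ i j I I) := @trivIset_seqDU _ B.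
  by move=> /(_ ij) /seteqP[+ _] => /(_ w); apply.
- apply/seteqP; split=> [w [i _ []//]|w Ew].
  by have [i si iw] := Bcover w; exists (Ordinal si).
Qed.

End RiemannSums.

(** * The filter of Riemann sums and its limit *)

Section RiemannFilter.
Context (R : realType) (T : pointedMetricType R) (X : completeNormedModType R).
Context (Tcompact : compact [set: T]).
Variables (mu : {finite_measure set (borel T) -> \bar R}) (F : T -> set X).
Context (F_cwk : forall t, cwk (F t)).

Definition riemann_filter (E : set T) : set_system (set X) :=
  [set A | exists2 gamma : T -> R, is_gauge gamma &
    forall k (P : 'I_k -> set T) (t : 'I_k -> T),
      is_partition mu E P -> is_fine gamma P t -> A (riemann_sum mu F P t)].

(** Existence of fine partitions gives properness; pointwise minima of gauges give intersections. *)
Lemma riemann_filter_proper (E : set T) :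
  measurable (E : set (borel T)) -> ProperFilter (riemann_filter E).
Proof.
move=> mE; apply: Build_ProperFilter_ex.
  move=> A [gamma gamma0 AE].
  have [k [P [t [EP Pt]]]] := fine_partition_exists mu Tcompact gamma0 mE.
  by exists (riemann_sum mu F P t); exact: AE.
split.
- by exists (fun=> 1) => // t; exact: ltr01.
- move=> A B [gA gA0 AE] [gB gB0 BE].
  exists (fun t => Num.min (gA t) (gB t)) => [t|k P t EP Pt].
    by rewrite lt_min gA0 gB0.
  by split; [apply: AE => // i w /Pt|apply: BE => // i w /Pt];
    rewrite lt_min => /andP[].
- move=> A B AB [gamma gamma0 AE]; exists gamma => // k P t EP Pt.
  by apply: AB; exact: AE.
Qed.

Lemma riemann_filter_cwk (E : set T) : \forall S \near riemann_filter E, cwk S.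
Proof.
by exists (fun=> 1) => [t|k P t _ _]; [exact: ltr01|exact: cwk_riemann_sum].
Qed.

(* Both sums are completed by a common sum over the complement of E, which is
   then cancelled. *)
Lemma riemann_filter_cauchy (E : set T) (J : set X) :
  measurable (E : set (borel T)) -> is_Hintegral mu F [set: T] J ->
  hausdorff_cauchy (riemann_filter E).
Proof.
(* A completed sum is at distance at most [e / 8] from [J], hence strictly within [e / 4]; two such
   errors leave [e / 2] after cancellation, below [e]. *)
move=> mE [_ FJ] e e0; have e8 : 0 < e / 8 by lra.
have [gamma gamma0 gammaJ] := FJ _ e8.
have sub k1 (P1 : 'I_k1 -> set T) t1 k2 (P2 : 'I_k2 -> set T) t2 :
    is_partition mu E P1 -> is_fine gamma P1 t1 ->
    is_partition mu E P2 -> is_fine gamma P2 t2 ->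
    riemann_sum mu F P1 t1 `<=` thicken e (riemann_sum mu F P2 t2).
  move=> EP1 Pt1 EP2 Pt2 x Px.
  have [k [Q [t [EQ Qt]]]] :=
    fine_partition_exists mu Tcompact gamma0 (measurableC mE).
  have close l (P : 'I_l -> set T) s : is_partition mu E P -> is_fine gamma P s ->
      riemann_sum mu F (cat_fam P Q) (cat_fam s t) `<=` thicken (e / 4) J /\
      J `<=` thicken (e / 4) (riemann_sum mu F (cat_fam P Q) (cat_fam s t)).
    move=> EP Ps; have PQt := is_fine_cat Ps Qt.
    apply: hausdorff_dist_le_thicken (gammaJ _ _ _ (is_partition_cat EP EQ) PQt).
    by lra.
  have [_ P2conv P2wc] := cwk_riemann_sum mu P2 (fun i => F_cwk (t2 i)).
  have [Q0 _ Qwc] := cwk_riemann_sum mu Q (fun i => F_cwk (t i)).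
  have [|b P2b xb] := @weakly_compact_cancel _ _ _ _ x (e / 2) P2conv P2wc Qwc Q0.
    move=> c Qc; have [+ _] := close _ _ _ EP1 Pt1.
    move=> /(_ (x + c))[|j Jj xcj].
      by rewrite riemann_sum_cat; exists x => //; exists c.
    have [_ /(_ j Jj)[d]] := close _ _ _ EP2 Pt2.
    rewrite riemann_sum_cat => -[b P2b [c' Qc' <-]] jd.
    exists b, c'; split => //; apply: le_trans (ler_distD j _ _) _.
    by lra.
  by exists b => //; lra.
exists gamma => // k1 P1 t1 EP1 Pt1; exists gamma => // k2 P2 t2 EP2 Pt2.
by split; exact: sub.
Qed.

(** Large and strict inequalities are reconciled by halving the tolerance. *)
Lemma norm_integralE (E : set T) : measurable (E : set (borel T)) ->
  norm_integral mu F E = limit_set (riemann_filter E).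
Proof.
move=> mE; have FF := riemann_filter_proper mE.
apply/seteqP; split => z zE e e0.
  have e2 : 0 < e / 2 by lra.
  have [gamma gamma0 zgamma] := zE _ e2; exists gamma => // k P t EP Pt.
  apply/dist_to_lt; apply: le_lt_trans (zgamma k P t EP Pt) _.
  by rewrite lte_fin; lra.
have [gamma gamma0 zgamma] := zE _ e0; exists gamma => // k P t EP Pt.
exact/ltW/dist_to_lt/zgamma.
Qed.

(** Points of [J] are limits of the sums by Hausdorff closeness; conversely, limit points are
    adherent to [J], which is norm closed by weak compactness. *)
Lemma is_Hintegral_unique (E : set T) (J : set X) :
  measurable (E : set (borel T)) -> is_Hintegral mu F E J ->
  J = norm_integral mu F E.
Proof.
move=> mE [[J0 Jconv Jwc] FJ].
have FF := riemann_filter_proper mE; rewrite norm_integralE//.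
have nearJ e : 0 < e -> \forall S \near riemann_filter E,
    S `<=` thicken e J /\ J `<=` thicken e S.
  move=> e0; have e2 : 0 < e / 2 by lra.
  have [gamma gamma0 gammaJ] := FJ _ e2; exists gamma => // k P t EP Pt.
  by apply: hausdorff_dist_le_thicken (gammaJ _ _ _ EP Pt); lra.
apply/seteqP; split => [z Jz e e0|z Lz].
  by apply: filterS (nearJ e e0) => S [_]; apply.
apply: weakly_compact_closed => // e e0; have e2 : 0 < e / 2 by lra.
have [S [[SJ _] [c Sc zc]]] := filter_ex (filterI (nearJ _ e2) (Lz _ e2)).
by rewrite (splitr e); apply: thicken_trans zc _; exact: SJ.
Qed.

(** This contains the passage of H-integrability from [T] to [E]: the integral on [E] is constructed
    as a limit set. *)
Lemma is_Hintegral_norm_integral (E : set T) (J : set X) :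
  measurable (E : set (borel T)) -> is_Hintegral mu F [set: T] J ->
  is_Hintegral mu F E (norm_integral mu F E).
Proof.
move=> mE FJ; have FF := riemann_filter_proper mE; rewrite norm_integralE//.
have SC := riemann_filter_cwk E; have Fcauchy := riemann_filter_cauchy mE FJ.
split; first exact: cwk_limit_set.
move=> e e0.
have [gamma gamma0 close] := filterI (limit_set_sub_thicken Fcauchy e0)
                                     (sub_thicken_limit_set SC Fcauchy e0).
exists gamma => // k P t EP Pt; have [LS SL] := close k P t EP Pt.
exact: hausdorff_dist_le.
Qed.

End RiemannFilter.

Theorem proposition3p6 (R : realType) (T : pointedMetricType R)
    (Tcompact : compact [set: T])
    (mu : {finite_measure set (borel T) -> \bar R})
    (mu_regular : regular_measure mu)
    (mu_non_atomic : pointwise_non_atomic mu)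
    (X : completeNormedModType R)
    (F : T -> set X) (F_cwk : forall t, cwk (F t))
    (F_Hintegrable : Hintegrable mu F)
    (E : set T) (E_measurable : measurable (E : set (borel T))) :
  Hintegral mu F E = norm_integral mu F E /\ cwk (norm_integral mu F E).
Proof.
have [J FJ] := F_Hintegrable.
have EL := is_Hintegral_norm_integral Tcompact F_cwk E_measurable FJ.
split; last by case: EL.
(* Existence and uniqueness together exclude the default value [set0] of [Hintegral]. *)
by apply: xget_unique => // J'; exact: is_Hintegral_unique.
Qed.
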